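(* Let $\ell\geq3$ and $q,s\geq2$ be integers and let $1>x>1-\frac{q}{(q-1)\ell s}$. Write $\xi=x-\left(1-\frac{q}{(q-1)\ell s}\right)$ and let $\delta>0$. Let $G=(V,E)$ be a graph with $m$ edges and $\mathcal{C}$ an even generating set of $\mathcal{F}_q(V,E)$ of size $r$ satisfying $\ell(\mathcal{C}) \leq \ell$ and $s(\mathcal{C}) \leq s$. Then there is a value of $p\in(0,1)$ for which the joint flow-RC Markov chain for $(G,\mathcal{C})$ with parameters $x,p$ comes $\delta$-close (in total variation distance) to $\mu_{\mathrm{flow-RC}}$ with parameter $x$ in at most $\frac{2(m+r)}{\ell}\log((2m+r)\delta^{-1})\xi^{-1}$ steps.
   Context: Graphs are finite multigraphs with a fixed orientation. For $F\subseteq E$, a flow on $(V,F)$ is $f:F\to\mathbb{Z}_q$ with inflow equal to outflow (in $\mathbb{Z}_q$) at every vertex; $\mathcal{F}_q(V,E)$ is the set of flows on $G$. For an even subgraph $C$ (all degrees even), choose an Eulerian orientation of each component and let $\chi_C(e)=0$ for $e\notin C$, $\chi_C(e)=\pm1$ for $e\in C$ according to agreement with $G$'s orientation. An even generating set of $\mathcal{F}_q(V,E)$ is a set $\mathcal{C}$ of even subgraphs whose $\chi_C$ (mod $q$) generate it as a $\mathbb{Z}_q$-module; $\ell(\mathcal{C})=\max_C|C|$, $s(\mathcal{C})=\max_{e\in E}|\{C\in\mathcal{C}:e\in C\}|$. The joint flow-RC Markov chain with parameters $x,p\in(0,1)$ has state space $\Omega$ of pairs $(f,F)$ with $F\subseteq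 E$ and $f$ a flow on $(V,F)$, with transitions: for $e\in E\setminus F$, $(f,F)\to(f,F\cup\{e\})$ with probability $(1-p)x/m$; for $e\in F$ with $f(e)=0$, $(f,F)\to(f,F\setminus\{e\})$ with probability $(1-p)(1-x)/m$; for $t\in\{1,\dots,q-1\}$ and $C\in\mathcal{C}$ with $C\subseteq F$, $(f,F)\to(f+t\chi_C,F)$ with probability $p/(qr)$; all remaining probability stays at $(f,F)$. Its stationary distribution is $\mu_{\mathrm{flow-RC}}(f,F)=x^{|F|}(1-x)^{|E\setminus F|}/Z_{\mathrm{flow}}(G;q,x)$, where $Z_{\mathrm{flow}}(G;q,x)=\sum_{g\in\mathcal{F}_q(V,E)}x^{|\{e:g(e)\neq0\}|}$. *)

(* Defs.v *)
From mathcomp Require Import all_boot all_order all_algebra.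
From mathcomp Require Import reals exp.

Set Implicit Arguments.
Unset Strict Implicit.
Unset Printing Implicit Defensive.

Import Order.TTheory GRing.Theory Num.Theory.
Local Open Scope ring_scope.

(* Parallel edges and loops are allowed; the orientation is from [src e] to
   [tgt e]. *)
Record multigraph (V E : finType) := Multigraph { src : E -> V; tgt : E -> V }.

(* A flow f : F -> Z_q on (V, F) is represented by its extension by 0 to E. *)
Definition flow_on (V E : finType) (G : multigraph V E) (q : nat)
    (F : {set E}) (f : {ffun E -> 'Z_q}) : bool :=
  [forall e, (e \notin F) ==> (f e == 0)] &&
  [forall v, \sum_(e in F | tgt G e == v) f e == \sum_(e in F | src G e == v) f e].

Definition flow (V E : finType) (G : multigraph V E) (q : nat)
    (f : {ffun E -> 'Z_q}) : bool := flow_on G [set: E] f.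

(* A loop contributes 2 to the degree of its vertex. *)
Definition degree (V E : finType) (G : multigraph V E) (C : {set E}) (v : V) : nat :=
  (#|[set e in C | src G e == v]| + #|[set e in C | tgt G e == v]|)%N.

Definition even_subgraph (V E : finType) (G : multigraph V E) (C : {set E}) : Prop :=
  forall v, ~~ odd (degree G C v).

(* An orientation of a subgraph C is given by the set A of the edges on which it
   agrees with the orientation of G. *)
Definition otail (V E : finType) (G : multigraph V E) (A : {set E}) (e : E) : V :=
  if e \in A then src G e else tgt G e.

Definition ohead (V E : finType) (G : multigraph V E) (A : {set E}) (e : E) : V :=
  if e \in A then tgt G e else src G e.

Definition eulerian_orientation (V E : finType) (G : multigraph V E)
    (C A : {set E}) : Prop :=
  forall v, #|[set e in C | ohead G A e == v]| = #|[set e in C | otail G A e == v]|.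

Definition chi (E : finType) (q : nat) (C A : {set E}) : {ffun E -> 'Z_q} :=
  [ffun e => if e \in C then (if e \in A then 1 else -1) else 0].

(* [orient C] is the Eulerian orientation chosen for the even subgraph C. *)
Definition even_generating_set (V E : finType) (G : multigraph V E) (q : nat)
    (CC : {set {set E}}) (orient : {set E} -> {set E}) : Prop :=
  [/\ forall C, C \in CC -> even_subgraph G C,
      forall C, C \in CC -> eulerian_orientation G C (orient C)
    & forall g : {ffun E -> 'Z_q}, flow G g <->
        exists c : {set E} -> 'Z_q,
          forall e, g e = \sum_(C in CC) c C * chi q C (orient C) e].

Definition max_length (E : finType) (CC : {set {set E}}) : nat :=
  \max_(C in CC) #|C|.

Definition max_load (E : finType) (CC : {set {set E}}) : nat :=
  \max_(e : E) #|[set C in CC | e \in C]|.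

Definition flowRC_state (V E : finType) (G : multigraph V E) (q : nat) : finType :=
  {w : {ffun E -> 'Z_q} * {set E} | flow_on G w.2 w.1}.

Section Chain.
Context (R : realType) (V E : finType) (G : multigraph V E) (q : nat).
Context (CC : {set {set E}}) (orient : {set E} -> {set E}) (x p : R).

Local Notation Omega := (flowRC_state G q).

Definition flowRC_move (a b : Omega) : R :=
  let f := (val a).1 in
  let F := (val a).2 in
  let m : R := #|E|%:R in
  let r : R := #|CC|%:R in
  \sum_(e | (e \notin F) && (val b == (f, e |: F))) (1 - p) * x / m
  + \sum_(e | [&& e \in F, f e == 0 & val b == (f, F :\ e)])
      (1 - p) * (1 - x) / m
  + \sum_(t : 'Z_q | t != 0)
      \sum_(C in CC | (C \subset F) &&
          (val b == ([ffun e => f e + t * chi q C (orient C) e], F)))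
        p / (q%:R * r).

Definition flowRC_trans (a b : Omega) : R :=
  flowRC_move a b + (if a == b then 1 - \sum_c flowRC_move a c else 0).

(* Z_flow(G; q, x) *)
Definition Zflow : R :=
  \sum_(g : {ffun E -> 'Z_q} | flow G g) x ^+ #|[set e | g e != 0]|.

Definition mu_flowRC (a : Omega) : R :=
  x ^+ #|(val a).2| * (1 - x) ^+ #|~: (val a).2| / Zflow.

End Chain.

(* Law after t steps of the chain with transition matrix P started at a. *)
Fixpoint chain_law (R : realType) (T : finType) (P : T -> T -> R) (a : T)
    (t : nat) : T -> R :=
  if t is t'.+1 then fun b => \sum_c chain_law P a t' c * P c b
  else fun b => (a == b)%:R.

Definition total_variation (R : realType) (T : finType) (mu nu : T -> R) : R :=
  2^-1 * \sum_a `|mu a - nu a|.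

(* The number of steps t is the same for all initial states.  It is a natural
   number, so a negative time bound B is read as 0. *)
Definition close_within (R : realType) (T : finType) (P : T -> T -> R)
    (mu : T -> R) (delta B : R) : Prop :=
  exists t : nat, t%:R <= Num.max 0 B /\
    forall a : T, total_variation (chain_law P a t) mu <= delta.

(* Main.v *)
Require Import Defs.
From mathcomp Require Import all_boot all_order all_algebra.
From mathcomp Require Import reals sequences exp.
From mathcomp Require Import ring lra.
Set Implicit Arguments.
Unset Strict Implicit.
Unset Printing Implicit Defensive.
Import Order.TTheory GRing.Theory Num.Theory.
Local Open Scope ring_scope.

(* Path coupling in dual form.  Call two states adjacent if they differ by one
   edge of F, or by a multiple of one chi_C with C in F.  Any two states are
   joined by a path of length at most 2m + r through F = E.  One step of the
   chain averages a test function over resamplings of a single edge and shifts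
   along a single cycle.  If the test function varies by at most c on adjacent
   pairs, then with K = (q-1)s/q and L = (1-x)l its average varies by at most
     c (1 - (1-p)/m + K p/r)   on pairs differing by an edge,
     c (1 - p/r + L (1-p)/m)   on pairs differing by a cycle.
   Since KL < 1, some p makes both factors 1 - al with al > 0.  By reversibility
   the total variation distance after t steps is at most (2m+r) (1 - al)^t. *)

(** * Reversible finite chains and total variation *)

Section FiniteChains.
Context (R : realType) (T : finType) (P : T -> T -> R).

Definition transition_op (h : T -> R) (a : T) : R := \sum_b P a b * h b.

(** The last step of the law is moved onto the test function, so a claim about laws becomes one
    about iterates of the averaging operator. *)
Lemma chain_law_expectation a t (h : T -> R) :
  \sum_b chain_law P a t b * h b = iter t transition_op h a.
Proof.
elim: t h => [|t IH] h.
  rewrite (bigD1 a) //= eqxx mul1r big1 ?addr0 // => b ba.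
  by rewrite eq_sym (negPf ba) mul0r.
rewrite iterSr -IH /=.
under eq_bigr do rewrite mulr_suml.
rewrite exchange_big /=; apply: eq_bigr => c _.
by rewrite /transition_op mulr_sumr; apply: eq_bigr => b _; rewrite mulrA.
Qed.

Context (mu : T -> R).
Hypothesis mu_ge0 : forall a, 0 <= mu a.
Hypothesis mu_sum1 : \sum_a mu a = 1.
Hypothesis reversible : forall a b, mu a * P a b = mu b * P b a.
Hypothesis stochastic : forall a, \sum_b P a b = 1.

Lemma reversible_stationary (h : T -> R) t :
  \sum_a mu a * iter t transition_op h a = \sum_a mu a * h a.
Proof.
elim: t => //= t <-.
under eq_bigr do rewrite mulr_sumr.
rewrite exchange_big /=; apply: eq_bigr => b _.
under eq_bigr do rewrite mulrA reversible.
by rewrite -mulr_suml -mulr_sumr stochastic mulr1.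
Qed.

(* Test the difference of the two laws against its own sign. *)
Lemma total_variation_oscillation a t (eps : R) :
  (forall h, (forall b, `|h b| <= 1) ->
     forall c, iter t transition_op h a - iter t transition_op h c <= 2 * eps) ->
  total_variation (chain_law P a t) mu <= eps.
Proof.
move=> osc; rewrite /total_variation.
pose h b : R := Num.sg (chain_law P a t b - mu b).
(* Stationarity turns the [mu]-mean of [h] into the [mu]-mean of its iterate, and [sg y * y] is the
   absolute value of [y]. *)
have -> : \sum_b `|chain_law P a t b - mu b| =
    \sum_c mu c * (iter t transition_op h a - iter t transition_op h c).
  under [RHS]eq_bigr do rewrite mulrBr.
  rewrite sumrB -mulr_suml mu_sum1 mul1r reversible_stationary.
  rewrite -chain_law_expectation -sumrB; apply: eq_bigr => b _.
  by rewrite -mulrBl normrEsg mulrC.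
suff : \sum_c mu c * (iter t transition_op h a - iter t transition_op h c) <=
       \sum_c mu c * (2 * eps).
  rewrite -mulr_suml mu_sum1; lra.
apply: ler_sum => c _; apply: ler_wpM2l => //; apply: osc => b.
by rewrite /h normr_sg; case: (_ != _).
Qed.

End FiniteChains.

(** * Converting a contraction rate into a number of steps *)

(** This is e <= 3: from 1 - 1/6 <= e^(-1/6) one gets e <= (6/5)^6 < 3, and 6 is the least exponent
    for which this estimate suffices. *)
Lemma ln_ge1 (R : realType) (y : R) : 3 <= y -> 1 <= ln y.
Proof.
move=> y3; rewrite -ler_expR lnK ?posrE; last lra.
apply: le_trans y3.
have h := @expR_ge1Dx R (- 6^-1).
have e6 : expR (6^-1 : R) <= 6 / 5.
  have := expRxMexpNx_1 (6^-1 : R); have := @expR_gt0 R (6^-1).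
  by nra.
have -> : (1 : R) = 6%:R * 6^-1 by field.
rewrite expRM_natl.
apply: le_trans (_ : (6 / 5) ^+ 6 <= _).
  by apply: lerXn2r; rewrite ?nnegrE ?expR_ge0 //; lra.
lra.
Qed.

(* Rounding the time down to an integer costs one step; it is paid by the gap of
   one between the two relaxation times. *)
Lemma geometric_time (R : realType) (al be D delta : R) :
  0 < al <= 1 -> 0 < be -> al^-1 + 1 <= be^-1 -> 3 <= D -> 0 < delta < 1 ->
  exists t : nat, t%:R <= be^-1 * ln (D / delta) /\ D * (1 - al) ^+ t <= delta.
Proof.
move=> /andP[al0 al1] be0 gap D3 /andP[d0 d1].
have Dd0 : 0 < D / delta by apply: divr_gt0; lra.
have lam1 : 1 <= ln (D / delta).
  by apply: ln_ge1; rewrite ler_pdivlMr //; nra.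
set lam := ln _ in lam1 *.
have ai : 0 < al^-1 by rewrite invr_gt0.
have bi : 0 < be^-1 by rewrite invr_gt0.
have B0 : 0 <= be^-1 * lam by nra.
have /andP[tB Bt] := truncn_itv B0.
set t := Num.truncn _ in tB Bt.
exists t; split => //.
have tl : lam <= al * t%:R.
  (* The gap adds at least [lam] to the time, and [lam >= 1] covers the step lost to truncation. *)
  have : al^-1 * lam <= t%:R.
    move: Bt; rewrite -natr1; nra.
  by rewrite -ler_pdivrMl //.
have : (1 - al) ^+ t <= expR (- lam).
  apply: le_trans (_ : expR (- al) ^+ t <= _).
    apply: lerXn2r; rewrite ?nnegrE ?expR_ge0 //; first lra.
    exact: expR_ge1Dx.
  by rewrite -expRM_natl ler_expR mulrN lerN2 mulrC.
rewrite expRN /lam lnK ?posrE // invf_div => h.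
have D0 : 0 < D by apply: lt_le_trans D3; rewrite ltr0n.
by move: h; rewrite ler_pdivlMr // mulrC.
Qed.

(** * Flows supported on edge sets and shifts along cycles *)

Section Flows.
Context (V E : finType) (G : multigraph V E) (q : nat).
Implicit Types (f g : {ffun E -> 'Z_q}) (F C : {set E}).

(** Values outside [F] vanish, so conservation may be stated over all of [E]. Changing [F] then
    affects only the support condition. *)
Lemma flow_onP F f :
  reflect ((forall e, e \notin F -> f e = 0) /\ flow G f) (flow_on G F f).
Proof.
apply: (iffP andP) => [[/forallP sF /forallP fl]|[sF /andP[_ /forallP fl]]].
  have s0 e : e \notin F -> f e = 0 by move=> eF; apply/eqP/(implyP (sF e)).
  split=> //; apply/andP; split; first by apply/forallP => e; rewrite inE.
  apply/forallP => v; have /eqP := fl v.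
  rewrite 2!big_mkcondl /= => {}fl; apply/eqP.
  transitivity (\sum_(e | tgt G e == v) (if e \in F then f e else 0)).
    by apply: eq_big => e; rewrite ?inE //; case: ifPn => // /s0.
  by rewrite fl; apply: eq_big => e; rewrite ?inE //; case: ifPn => // /s0.
split; first by apply/forallP => e; apply/implyP => /sF ->.
apply/forallP => v; have /eqP := fl v.
under eq_bigl do rewrite inE /=; under [X in _ = X]eq_bigl do rewrite inE /=.
move=> {}fl; apply/eqP; rewrite 2!big_mkcondl /=.
transitivity (\sum_(e | tgt G e == v) f e).
  by apply: eq_bigr => e _; case: ifPn => // /sF.
by rewrite fl; apply: eq_bigr => e _; case: ifPn => // /sF.
Qed.

Lemma flow_on_setU1 F f e : flow_on G F f -> flow_on G (e |: F) f.
Proof.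
case/flow_onP => sF fl; apply/flow_onP; split=> // e'.
by rewrite !inE negb_or => /andP[_ /sF].
Qed.

Lemma flow_on_setD1 F f e : flow_on G F f -> f e = 0 -> flow_on G (F :\ e) f.
Proof.
case/flow_onP => sF fl fe; apply/flow_onP; split=> // e'.
by rewrite !inE negb_and negbK => /orP[/eqP-> //|/sF].
Qed.

Lemma flow_on_setT F f : flow_on G F f -> flow_on G setT f.
Proof. by case/flow_onP. Qed.

Context (CC : {set {set E}}) (orient : {set E} -> {set E}).
Hypothesis hCC : even_generating_set G q CC orient.

Definition add_cycle f C (t : 'Z_q) : {ffun E -> 'Z_q} :=
  [ffun e => f e + t * chi q C (orient C) e].

Lemma add_cycle0 f C : add_cycle f C 0 = f.
Proof. by apply/ffunP => e; rewrite ffunE mul0r addr0. Qed.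

Lemma add_cycleD f C t u : add_cycle (add_cycle f C t) C u = add_cycle f C (t + u).
Proof. by apply/ffunP => e; rewrite !ffunE mulrDl addrA. Qed.

Lemma add_cycleAC f C D t u :
  add_cycle (add_cycle f C t) D u = add_cycle (add_cycle f D u) C t.
Proof. by apply/ffunP => e; rewrite !ffunE addrAC. Qed.

Lemma add_cycle_out f C t e : e \notin C -> add_cycle f C t e = f e.
Proof. by move=> eC; rewrite !ffunE (negPf eC) mulr0 addr0. Qed.

(** On [C] the value of [chi] is a unit, so this is valid for composite [q] too. It prevents both
    flows from vanishing at [e]. *)
Lemma add_cycle_neq f C t e : e \in C -> t != 0 -> add_cycle f C t e != f e.
Proof.
move=> eC t0; rewrite !ffunE eC -subr_eq0 addrC addKr.
by case: ifP => _; rewrite ?mulr1 ?mulrN1 ?oppr_eq0.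
Qed.

(** Conservation comes from the generating property: the shift only raises the coefficient of [C] by
    [t]. *)
Lemma flow_on_add_cycle F f C t :
  flow_on G F f -> C \in CC -> C \subset F -> flow_on G F (add_cycle f C t).
Proof.
case/flow_onP => sF fl CCC sCF; apply/flow_onP; split=> [e eF|].
  by rewrite add_cycle_out ?sF //; apply: contra eF; apply/subsetP.
case: hCC => [_ _ gen]; have [c fc] := (gen f).1 fl; apply/gen.
exists (fun D => c D + (if D == C then t else 0)) => e.
under eq_bigr do rewrite mulrDl.
rewrite ffunE fc big_split /=; congr (_ + _).
rewrite (bigD1 C) //= eqxx big1 ?addr0 // => D /andP[_ /negPf->].
by rewrite mul0r.
Qed.

(** Subtracting the coefficients of the two flows leaves one shift per member of [CC]; this is the
    [r] in the diameter 2m + r. *)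
Lemma flow_generated f g :
  flow G f -> flow G g -> exists c : {set E} -> 'Z_q,
    g = foldl (fun f C => add_cycle f C (c C)) f (enum CC).
Proof.
case: hCC => [_ _ gen] /gen[c fc] /gen[d gd]; exists (fun C => d C - c C).
have fold_val (s : seq {set E}) h e :
    foldl (fun f C => add_cycle f C (d C - c C)) h s e =
    h e + \sum_(C <- s) (d C - c C) * chi q C (orient C) e.
  elim: s h => [|C s IH] h /=; first by rewrite big_nil addr0.
  by rewrite IH big_cons ffunE addrA.
apply/ffunP => e; rewrite fold_val fc gd -big_enum /= [in RHS]big_enum /=.
rewrite -big_split /= big_enum /=; apply: eq_bigr => C _.
by rewrite -mulrDl addrC subrK.
Qed.

End Flows.

(** * Lipschitz functions and contraction of one averaged step *)

Section Contraction.
Context (R : realType) (V E : finType) (G : multigraph V E) (q : nat).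
Context (CC : {set {set E}}) (orient : {set E} -> {set E}).
Hypothesis hCC : even_generating_set G q CC orient.
Hypothesis q_gt1 : (1 < q)%N.
Context (x : R).
Hypotheses (x_gt0 : 0 < x) (x_lt1 : x < 1).

Local Notation config := ({ffun E -> 'Z_q} * {set E})%type.
Implicit Types (f : {ffun E -> 'Z_q}) (F C : {set E}) (g : config -> R).
Local Notation add_cycle := (add_cycle orient).

Lemma sum_if_const (T : finType) (A B : {pred T}) (c d : R) :
  \sum_(i in A) (c + (if i \in B then d else 0)) =
  #|A|%:R * c + #|[set i in A | i \in B]|%:R * d.
Proof.
rewrite big_split /= sumr_const -big_mkcondr /= -big_set /= sumr_const.
by rewrite !mulr_natl.
Qed.

Lemma natq_gt0 : 0 < q%:R :> R.
Proof. by rewrite ltr0n; case: q q_gt1. Qed.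

Lemma card_Zq : #|'Z_q| = q.
Proof. by rewrite card_ord Zp_cast. Qed.

(** Only q - 1 of the q terms carry the surcharge [d]. This is the source of the factor (q-1)/q. *)
Lemma norm_average_le (k : 'Z_q -> R) c d :
  `|k 0| <= c -> (forall t, t != 0 -> `|k t| <= c + d) ->
  `|q%:R^-1 * \sum_t k t| <= c + (q%:R - 1) / q%:R * d.
Proof.
move=> k0 kt; have q0 := natq_gt0.
rewrite normrM (ger0_norm (ltW _)) ?invr_gt0 // ler_pdivrMl //.
apply: le_trans (ler_norm_sum _ _ _) _.
have h : \sum_t `|k t| <= c + \sum_(t : 'Z_q | t != 0) (c + d).
  by rewrite (bigD1 0) //=; apply: lerD => //; apply: ler_sum.
apply: le_trans h _.
have -> : \sum_(t : 'Z_q | t != 0) (c + d) = (q%:R - 1) * (c + d).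
  rewrite (eq_bigl (fun t => t \in predC1 (0 : 'Z_q))) // sumr_const.
  rewrite cardC1 card_Zq -[LHS]mulr_natl.
  by rewrite -subn1 (natrB _ (ltnW q_gt1)).
rewrite le_eqVlt; apply/orP; left; apply/eqP; field; lra.
Qed.

(** Heat-bath resampling of one edge. Insertion and deletion share a formula, since inserting a
    present edge or deleting an absent one changes nothing. *)
Definition edge_average e g (w : config) : R :=
  if w.1 e == 0 then x * g (w.1, e |: w.2) + (1 - x) * g (w.1, w.2 :\ e)
  else g w.

(** The shift is uniform on Z_q, including 0, so that averaging along [C] is invariant under shifts
    along [C]. *)
Definition cycle_average C g (w : config) : R :=
  if C \subset w.2 then q%:R^-1 * \sum_t g (add_cycle w.1 C t, w.2) else g w.

(** Test functions live on all pairs, but only pairs carrying a flow are compared. *)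
Definition lipschitz g (c : R) :=
  (forall f F e, flow_on G F f -> `|g (f, e |: F) - g (f, F)| <= c) /\
  (forall f F C t, flow_on G F f -> C \in CC -> C \subset F ->
     `|g (add_cycle f C t, F) - g (f, F)| <= c).

Lemma norm_scale_bounds (y u c : R) :
  0 <= y -> `|u| <= c -> - (y * c) <= y * u <= y * c.
Proof. by move=> y0 uc; rewrite -ler_norml normrM ger0_norm // ler_wpM2l. Qed.

Lemma norm_mix_le (u v c : R) :
  `|u| <= c -> `|v| <= c -> `|x * u + (1 - x) * v| <= c.
Proof.
move=> /(norm_scale_bounds (ltW x_gt0)) /andP[? ?].
have x1 : 0 <= 1 - x by rewrite subr_ge0 ltW.
move=> /(norm_scale_bounds x1) /andP[? ?].
by rewrite ler_norml; apply/andP; split; lra.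
Qed.

Section Lipschitz.
Context (g : config -> R) (c : R).
Hypotheses (c_ge0 : 0 <= c) (lip_g : lipschitz g c).

(** Resampling [e0] erases the discrepancy because [f] vanishes there; resampling any other edge
    commutes with inserting [e0]. *)
Lemma edge_average_lip_edge e0 f F e : flow_on G F f -> e0 \notin F ->
  `|edge_average e g (f, e0 |: F) - edge_average e g (f, F)|
    <= c + (if e \in pred1 e0 then - c else 0).
Proof.
move=> fl e0F; rewrite /edge_average /= inE.
have [lip1 lip2] := lip_g.
have [->|ne] := eqVneq e e0.
  have /flow_onP[/(_ _ e0F) -> _] := fl.
  rewrite eqxx setUA setUid setU1K // (setDidPl _) ?subrr ?normr0 //.
  by rewrite disjoint_sym disjoints1.
rewrite addr0; case: eqP => fe; last exact: lip1.
have -> : (e0 |: F) :\ e = e0 |: (F :\ e).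
  by apply/setP => y; rewrite !inE; case: (eqVneq y e0) => [->|//]; rewrite eq_sym ne.
have -> : e |: (e0 |: F) = e0 |: (e |: F) by rewrite setUCA.
rewrite opprD addrACA -!mulrBr.
by apply: norm_mix_le; apply: lip1; [exact: flow_on_setU1 | exact: flow_on_setD1].
Qed.

(** If [C] is available on both sides, the same [t] is used on both. It is available on one side
    only if it passes through [e0]; a nonzero shift then costs an extra [c]. *)
Lemma cycle_average_lip_edge e0 f F C : flow_on G F f -> C \in CC ->
  `|cycle_average C g (f, e0 |: F) - cycle_average C g (f, F)|
    <= c + (if C \in [set D : {set E} | e0 \in D] then (q%:R - 1) / q%:R * c else 0).
Proof.
move=> fl CCC; rewrite /cycle_average /= inE.
have [lip1 lip2] := lip_g.
have q0 := natq_gt0.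
have q1 : 0 <= (q%:R - 1 : R) by rewrite subr_ge0 ler1n ltnW.
have extra : 0 <= (if e0 \in C then (q%:R - 1) / q%:R * c else 0).
  by case: ifP => // _; rewrite mulr_ge0 // divr_ge0 // ltW.
have [CF|CF] := boolP (C \subset F).
  rewrite (subset_trans CF) ?subsetUr // -mulrBr -sumrB.
  apply: le_trans (_ : c + (q%:R - 1) / q%:R * 0 <= _); last by rewrite mulr0 lerD2l.
  apply: norm_average_le => [|t _]; rewrite ?addr0;
    by apply: lip1; apply: (flow_on_add_cycle hCC).
have [CF'|CF'] := boolP (C \subset e0 |: F); last first.
  by apply: le_trans (lip1 _ _ _ fl) _; rewrite lerDl.
have -> : e0 \in C.
  apply: contraR CF => e0C; apply/subsetP => y yC.
  have := subsetP CF' y yC; rewrite !inE => /orP[/eqP ye|//].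
  by rewrite -ye yC in e0C.
(* The unshifted side is written as a constant average so that the two sides can be compared for
   each [t]. *)
have -> : g (f, F) = q%:R^-1 * \sum_(t : 'Z_q) g (f, F).
  rewrite sumr_const (_ : #|_| = q); last exact: card_Zq.
  by rewrite -[g _ *+ q]mulr_natl mulKf // gt_eqF.
rewrite -mulrBr -sumrB.
have fl' := flow_on_setU1 e0 fl.
apply: norm_average_le => [|t _]; first by rewrite add_cycle0; apply: lip1.
have := lip2 f _ C t fl' CCC CF'; have := lip1 f F e0 fl.
by rewrite !ler_norml; lra.
Qed.

(** Off [C0] the flows agree at [e] and are resampled alike. On [C0] at most one of them vanishes at
    [e], and only that side can lose [e], with probability 1 - x. *)
Lemma edge_average_lip_cycle C0 f F t e : flow_on G F f -> C0 \in CC ->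
  C0 \subset F -> t != 0 ->
  `|edge_average e g (add_cycle f C0 t, F) - edge_average e g (f, F)|
    <= c + (if e \in C0 then (1 - x) * c else 0).
Proof.
move=> fl CCC CF t0; rewrite /edge_average /=.
have [lip1 lip2] := lip_g.
have fl' := flow_on_add_cycle hCC t fl CCC CF.
have [eC|eC] := boolP (e \in C0); last first.
  rewrite addr0 add_cycle_out //; case: eqP => fe; last exact: lip2.
  rewrite opprD addrACA -!mulrBr; apply: norm_mix_le; apply: lip2 => //.
  - exact: flow_on_setU1.
  - by rewrite (subset_trans CF) ?subsetUr.
  - exact: flow_on_setD1.
  - by rewrite subsetD1 CF.
have x1 : 0 <= 1 - x by rewrite subr_ge0 ltW.
have eF : e |: F = F by apply/setUidPr; rewrite sub1set (subsetP CF).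
have drop h : flow_on G F h -> h e = 0 ->
    `|g (h, F :\ e) - g (h, F)| <= c.
  move=> flh he; rewrite distrC -{1}(setD1K (subsetP CF _ eC)).
  exact/lip1/flow_on_setD1.
have ne := add_cycle_neq orient f eC t0.
have := lip2 f F C0 t fl CCC CF.
rewrite eF; case: eqP => f'e; case: eqP => fe; first by rewrite f'e fe eqxx in ne.
- have := norm_scale_bounds x1 (drop _ fl' f'e).
  by rewrite !ler_norml => /andP[? ?] /andP[? ?]; apply/andP; split; lra.
- have := norm_scale_bounds x1 (drop _ fl fe).
  by rewrite !ler_norml => /andP[? ?] /andP[? ?]; apply/andP; split; lra.
- move=> h; apply: le_trans h _; by rewrite lerDl mulr_ge0.
Qed.

(** Averaging along [C0] absorbs the shift by translating [t]; shifts along other cycles commute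
    with it. *)
Lemma cycle_average_lip_cycle C0 f F t C : flow_on G F f -> C0 \in CC ->
  C0 \subset F -> C \in CC ->
  `|cycle_average C g (add_cycle f C0 t, F) - cycle_average C g (f, F)|
    <= c + (if C \in pred1 C0 then - c else 0).
Proof.
move=> fl CC0 CF0 CCC; rewrite /cycle_average /= inE.
have [lip1 lip2] := lip_g.
have [->|ne] := eqVneq C C0.
  rewrite CF0 [X in _ * X - _](_ : _ = \sum_u g (add_cycle f C0 u, F)).
    by rewrite !subrr normr0.
  rewrite [RHS](reindex_inj (addrI t)) /=.
  by apply: eq_bigr => u _; rewrite add_cycleD.
rewrite addr0; case: ifP => CF; last exact: lip2.
rewrite -mulrBr -sumrB.
apply: le_trans (_ : c + (q%:R - 1) / q%:R * 0 <= _); last by rewrite mulr0 addr0.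
apply: norm_average_le => [|u _]; rewrite ?addr0 add_cycleAC;
  by apply: lip2 => //; apply: (flow_on_add_cycle hCC).
Qed.

(** The path has three legs: fill [F] up to [E], shift [f] to [f'] where every cycle is available,
    then descend to [F']. They cost m, r and m. *)
Lemma lipschitz_diameter f F f' F' : flow_on G F f -> flow_on G F' f' ->
  `|g (f, F) - g (f', F')| <= (2 * #|E| + #|CC|)%:R * c.
Proof.
have [lip1 lip2] := lip_g.
have fill h H : flow_on G H h -> `|g (h, setT) - g (h, H)| <= #|E|%:R * c.
  have fillseq (s : seq E) K : flow_on G K h ->
      `|g (h, foldl (fun F e => e |: F) K s) - g (h, K)| <= (size s)%:R * c.
    elim: s K => [|e s IH] K flK /=; first by rewrite subrr normr0 mul0r.
    have := IH _ (flow_on_setU1 e flK); have := lip1 _ _ e flK.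
    by rewrite -natr1 !ler_norml => /andP[? ?] /andP[? ?]; apply/andP; split; lra.
  have foldU (s : seq E) K : {subset s <= foldl (fun F e => e |: F) K s}
      /\ {subset K <= foldl (fun F e => e |: F) K s}.
    elim: s K => [|e s IH] K /=; first by split.
    have [s1 s2] := IH (e |: K).
    split=> y; last by move=> yK; apply: s2; rewrite inE yK orbT.
    by rewrite inE => /orP[/eqP->|/s1 //]; apply: s2; rewrite !inE eqxx.
  move=> flH; have := fillseq (enum E) H flH; rewrite -cardE.
  suff -> : foldl (fun F e => e |: F) H (enum E) = setT by [].
  by apply/setP => e; rewrite inE; apply: (foldU _ _).1; rewrite mem_enum.
move=> fl fl'; have := fill _ _ fl; have := fill _ _ fl'.
have walk : `|g (f', setT) - g (f, setT)| <= #|CC|%:R * c.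
  have [d ->] := flow_generated hCC (elimT (flow_onP _ _ _) fl).2
                                   (elimT (flow_onP _ _ _) fl').2.
  rewrite cardE; have : {subset enum CC <= CC} by move=> C; rewrite mem_enum.
  have := flow_on_setT fl; move: (enum CC) => s.
  elim: s f {fl} => [|C s IH] h flh sC /=; first by rewrite subrr normr0 mul0r.
  have CCC : C \in CC by apply: sC; rewrite inE eqxx.
  have flh' := flow_on_add_cycle hCC (d C) flh CCC (subsetT C).
  have := IH _ flh' (fun y ys => sC y (mem_behead (s := C :: s) ys)).
  have := lip2 _ _ _ (d C) flh CCC (subsetT C).
  by rewrite -natr1 !ler_norml => /andP[? ?] /andP[? ?]; apply/andP; split; lra.
move: walk; rewrite natrD natrM !ler_norml.
by move=> /andP[? ?] /andP[? ?] /andP[? ?]; apply/andP; split; lra.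
Qed.

End Lipschitz.

Context (a b : R).
Hypotheses (a_ge0 : 0 <= a) (b_ge0 : 0 <= b).
Hypothesis ab_le1 : b * #|E|%:R + a * #|CC|%:R <= 1.

(** Each edge has rate [b] and each cycle rate [a], later (1-p)/m and p/r. The remaining mass is
    positive when m or r is 0. *)
Definition average_op g (w : config) : R :=
  (1 - (b * #|E|%:R + a * #|CC|%:R)) * g w
  + b * \sum_e edge_average e g w + a * \sum_(C in CC) cycle_average C g w.

Lemma average_op_diff g u v (c B1 B2 : R) :
  `|g u - g v| <= c ->
  \sum_e `|edge_average e g u - edge_average e g v| <= B1 ->
  \sum_(C in CC) `|cycle_average C g u - cycle_average C g v| <= B2 ->
  `|average_op g u - average_op g v| <=
    (1 - (b * #|E|%:R + a * #|CC|%:R)) * c + b * B1 + a * B2.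
Proof.
move=> h0 h1 h2.
have {h1} := le_trans (ler_norm_sum _ _ _) h1.
have {h2} := le_trans (ler_norm_sum _ _ _) h2.
rewrite !sumrB => /(norm_scale_bounds a_ge0) /andP[? ?].
move=> /(norm_scale_bounds b_ge0) /andP[? ?].
have k0 : 0 <= 1 - (b * #|E|%:R + a * #|CC|%:R) by rewrite subr_ge0.
have /andP[? ?] := norm_scale_bounds k0 h0.
by rewrite /average_op ler_norml; apply/andP; split; lra.
Qed.

(** For an edge pair one edge heals and at most [s] cycles do harm; for a cycle pair one cycle heals
    and at most [l] edges do harm. The second rate condition is guarded because without cycles p/r
    is 0, which would exclude every positive [al]. *)
Lemma average_op_contracts (al : R) (s l : nat) g c :
  (max_load CC <= s)%N -> (max_length CC <= l)%N ->
  al <= b - a * ((q%:R - 1) / q%:R * s%:R) ->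
  ((0 < #|CC|)%N -> al <= a - b * ((1 - x) * l%:R)) ->
  al <= 1 -> 0 <= c -> lipschitz g c -> lipschitz (average_op g) ((1 - al) * c).
Proof.
move=> /bigmax_leqP hs /bigmax_leqP hl al1 al2 al_le1 c0 lip_g.
have q0 := natq_gt0.
have kq : 0 <= (q%:R - 1) / q%:R :> R.
  by rewrite divr_ge0 ?(ltW q0) // subr_ge0 ler1n ltnW.
split=> [f F e0 fl|f F C0 t fl CC0 CF0].
  have [e0F|e0F] := boolP (e0 \in F).
    have -> : e0 |: F = F by apply/setUidPr; rewrite sub1set.
    by rewrite subrr normr0 mulr_ge0 // subr_ge0.
  have h1 : \sum_e `|edge_average e g (f, e0 |: F) - edge_average e g (f, F)|
      <= #|E|%:R * c - c.
    apply: le_trans (ler_sum _ (fun e _ => edge_average_lip_edge lip_g e fl e0F)) _.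
    rewrite (sum_if_const predT) (_ : #|[set _ in _ | _]| = 1%N) ?mul1r //.
    by rewrite -(cards1 e0); apply: eq_card => e; rewrite !inE.
  have h2 : \sum_(C in CC)
      `|cycle_average C g (f, e0 |: F) - cycle_average C g (f, F)|
      <= #|CC|%:R * c + s%:R * ((q%:R - 1) / q%:R * c).
    apply: le_trans (ler_sum _ (fun C => cycle_average_lip_edge c0 lip_g e0 fl)) _.
    rewrite sum_if_const lerD2l; apply: ler_wpM2r; first by rewrite mulr_ge0.
    rewrite ler_nat; apply: leq_trans (hs e0 isT); rewrite subset_leq_card //.
    by apply/subsetP => C; rewrite !inE.
  apply: le_trans (average_op_diff (lip_g.1 _ _ _ fl) h1 h2) _.
  have := ler_wpM2r c0 al1; set K := _ / _; lra.
have [->|t0] := eqVneq t 0.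
  by rewrite add_cycle0 subrr normr0 mulr_ge0 // subr_ge0.
have h1 : \sum_e `|edge_average e g (add_cycle f C0 t, F) - edge_average e g (f, F)|
    <= #|E|%:R * c + l%:R * ((1 - x) * c).
  apply: le_trans
    (ler_sum _ (fun e _ => edge_average_lip_cycle c0 lip_g e fl CC0 CF0 t0)) _.
  rewrite (sum_if_const predT) lerD2l; apply: ler_wpM2r.
    by rewrite mulr_ge0 // subr_ge0 ltW.
  rewrite ler_nat; apply: leq_trans (hl C0 CC0); rewrite subset_leq_card //.
  by apply/subsetP => C; rewrite !inE.
have h2 : \sum_(C in CC)
    `|cycle_average C g (add_cycle f C0 t, F) - cycle_average C g (f, F)|
    <= #|CC|%:R * c - c.
  apply: le_trans
    (ler_sum _ (fun C => cycle_average_lip_cycle lip_g t fl CC0 CF0)) _.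
  rewrite sum_if_const (_ : #|[set _ in _ | _]| = 1%N) ?mul1r //.
  rewrite -(cards1 C0); apply: eq_card => C; rewrite !inE.
  by case: eqP => [->|]; rewrite ?andbF // CC0.
apply: le_trans (average_op_diff (lip_g.2 _ _ _ _ fl CC0 CF0) h1 h2) _.
have /al2/(ler_wpM2r c0) : (0 < #|CC|)%N by apply/card_gt0P; exists C0.
lra.
Qed.

End Contraction.

(** * The flow-RC chain: averaging form, reversibility, mixing *)

Section FlowRC.
Context (R : realType) (V E : finType) (G : multigraph V E) (q : nat).
Context (CC : {set {set E}}) (orient : {set E} -> {set E}).
Hypothesis hCC : even_generating_set G q CC orient.
Hypothesis q_gt1 : (1 < q)%N.
Context (x p : R).
Hypotheses (x_gt0 : 0 < x) (x_lt1 : x < 1).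

Local Notation config := ({ffun E -> 'Z_q} * {set E})%type.
Local Notation Omega := (flowRC_state G q).
Local Notation move := (@flowRC_move R V E G q CC orient x p).
Local Notation trans := (@flowRC_trans R V E G q CC orient x p).
Local Notation mu := (@mu_flowRC R V E G q x).
Local Notation add_cycle := (add_cycle orient).

(** Every target is a legal state, hence the value of exactly one [b]; moves with a common target
    are counted separately on both sides. *)
Lemma sum_state_moves (I : finType) (P : pred I) (w : I -> config) (k : R)
    (h : config -> R) :
  (forall i, P i -> flow_on G (w i).2 (w i).1) ->
  \sum_(b : Omega) (\sum_(i | P i && (val b == w i)) k) * h (val b) =
  \sum_(i | P i) k * h (w i).
Proof.
move=> flw; under eq_bigr do rewrite mulr_suml.
rewrite (exchange_big_dep P) /=; last by move=> b i _ /andP[].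
apply: eq_bigr => i Pi.
rewrite (big_pred1 (Sub (w i) (flw i Pi) : Omega)) ?SubK // => b.
by rewrite Pi /= -val_eqE.
Qed.

(** Completing the moves to full averages adds only moves that fix the state, so it merely relabels
    holding probability. Working with increments of [g] makes that probability drop out. *)
Lemma transition_op_average (g : config -> R) (a : Omega) :
  transition_op trans (fun b => g (val b)) a =
  average_op CC orient x (p / #|CC|%:R) ((1 - p) / #|E|%:R) g (val a).
Proof.
pose h w := g w - g (val a).
have -> : transition_op trans (fun b => g (val b)) a =
    g (val a) + \sum_b move a b * h (val b).
  rewrite /transition_op /flowRC_trans.
  under eq_bigr do rewrite mulrDl; rewrite big_split /=.
  rewrite [X in _ + X = _](_ : _ = (1 - \sum_c move a c) * g (val a)); last first.
    set S := \sum_c move a c; rewrite (bigD1 a) //= eqxx big1 ?addr0 // => b ba.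
    by rewrite eq_sym (negPf ba) mul0r.
  rewrite /h; under [in RHS]eq_bigr do rewrite mulrBr.
  by rewrite sumrB -mulr_suml; ring.
have fa : flow_on G (val a).2 (val a).1 := valP a.
rewrite /flowRC_move; under eq_bigr do rewrite 2!mulrDl; rewrite !big_split /=.
move: fa; rewrite {}/h /=; case: (sval a) => f F /= fl; pose h w := g w - g (f, F).
rewrite [X in _ + (X + _ + _)](sum_state_moves _ (w := fun e => (f, e |: F))
  (P := fun e => e \notin F) h);
  last by move=> e _; apply: flow_on_setU1.
under [X in _ + (_ + X + _)]eq_bigr do under eq_bigl do rewrite andbA.
rewrite [X in _ + (_ + X + _)](sum_state_moves _ (w := fun e => (f, F :\ e))
  (P := fun e => (e \in F) && (f e == 0)) h);
  last by move=> e /andP[_ /eqP ?]; apply: flow_on_setD1.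
have -> : \sum_(b : Omega) (\sum_(t : 'Z_q | t != 0)
      \sum_(C in CC | (C \subset F) &&
          (val b == ([ffun e => f e + t * chi q C (orient C) e], F)))
        p / (q%:R * #|CC|%:R)) * h (val b) =
    \sum_(t : 'Z_q | t != 0) \sum_(C in CC | C \subset F)
      p / (q%:R * #|CC|%:R) * h (add_cycle f C t, F).
  under eq_bigr do rewrite mulr_suml; rewrite exchange_big /=.
  apply: eq_bigr => t _.
  under eq_bigr do under eq_bigl do rewrite andbA.
  rewrite [LHS](sum_state_moves _ (w := fun C => (add_cycle f C t, F))
    (P := fun C => (C \in CC) && (C \subset F)) h) //.
  by move=> C /andP[? ?] /=; apply: (flow_on_add_cycle hCC).
set m := #|E|%:R; set r := #|CC|%:R.
have -> : average_op CC orient x (p / r) ((1 - p) / m) g (f, F) =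
    g (f, F) + (1 - p) / m * \sum_e (edge_average x e g (f, F) - g (f, F))
    + p / r * \sum_(C in CC) (cycle_average orient C g (f, F) - g (f, F)).
  rewrite /average_op !sumrB !sumr_const -[_ *+ #|E|]mulr_natl.
  by rewrite -[g _ *+ #|CC|]mulr_natl -/m -/r; ring.
rewrite -[RHS]addrA; congr (_ + (_ + _)).
  rewrite big_mkcond [X in _ + X]big_mkcond -big_split mulr_sumr /=.
  apply: eq_bigr => e _; rewrite /edge_average /=.
  case: (boolP (e \in F)) => eF /=.
    case: eqP => fe; last by rewrite subrr mulr0 addr0.
    have -> : e |: F = F by apply/setUidPr; rewrite sub1set.
    by rewrite /h; ring.
  have /flow_onP[/(_ _ eF) -> _] := fl; rewrite eqxx.
  have -> : F :\ e = F by apply/setDidPl; rewrite disjoint_sym disjoints1.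
  by rewrite /h; ring.
rewrite exchange_big /= big_mkcondr mulr_sumr /=.
apply: eq_bigr => C CCC; rewrite /cycle_average /=.
case: ifP => CF; last by rewrite subrr mulr0.
rewrite -mulr_sumr (_ : \sum_(t | t != 0) _ = \sum_t h (add_cycle f C t, F)).
  rewrite sumrB sumr_const (_ : #|_| = q); last exact: card_Zq.
  rewrite -[g _ *+ q]mulr_natl invfM.
  have q0 : q%:R != 0 :> R by rewrite pnatr_eq0; case: q q_gt1.
  (* The inverse of [r] is generalised because [r] may be 0; only [q] must be nonzero. *)
  by move: (r^-1) => ri; field.
by rewrite [RHS](bigD1 0) //= add_cycle0 /h subrr add0r.
Qed.

Lemma trans_stochastic (a : Omega) : \sum_b trans a b = 1.
Proof.
rewrite big_split /= (bigD1 a) //= [X in _ + X](bigD1 a) //= eqxx.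
rewrite [X in _ + (_ + X)]big1 => [|b ba]; last by rewrite eq_sym (negPf ba).
by rewrite addr0 addrC subrK.
Qed.

Lemma add_edge_remove_edge (e : E) (f f' : {ffun E -> 'Z_q}) (F F' : {set E}) :
  flow_on G F f ->
  ((e \notin F) && ((f', F') == (f, e |: F))) =
  [&& e \in F', f' e == 0 & (f, F) == (f', F' :\ e)].
Proof.
case/flow_onP => sF _; apply/andP/and3P.
  by case=> eF /eqP[-> ->]; rewrite setU1K // !inE eqxx sF.
by case=> eF' _ /eqP[-> ->]; rewrite !inE eqxx setD1K.
Qed.

(** Inserting an edge multiplies the weight by x/(1-x), which balances the two edge rates. A cycle
    shift keeps [F], hence the weight, and is undone by [-t]. *)
Lemma mu_reversible (a b : Omega) : mu a * trans a b = mu b * trans b a.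
Proof.
have [->//|ab] := eqVneq a b.
rewrite /flowRC_trans [b == a]eq_sym (negPf ab) !addr0.
have fa : flow_on G (val a).2 (val a).1 := valP a.
have fb : flow_on G (val b).2 (val b).1 := valP b.
rewrite /flowRC_move /mu_flowRC.
move: fa fb; case: (val a) (val b) => [f F] [f' F'] /= fa fb.
have up_down (h h' : {ffun E -> 'Z_q}) (H H' : {set E}) : flow_on G H h ->
    x ^+ #|H| * (1 - x) ^+ #|~: H| / Zflow G q x *
      \sum_(e | (e \notin H) && ((h', H') == (h, e |: H))) (1 - p) * x / #|E|%:R =
    x ^+ #|H'| * (1 - x) ^+ #|~: H'| / Zflow G q x *
      \sum_(e | [&& e \in H', h' e == 0 & (h, H) == (h', H' :\ e)])
        (1 - p) * (1 - x) / #|E|%:R.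
  move=> flh; rewrite !mulr_sumr; apply: eq_big => e; first exact: add_edge_remove_edge.
  case/andP => eH /eqP[_ ->].
  have -> : #|e |: H| = #|H|.+1 by rewrite cardsU1 eH.
  have -> : #|~: H| = #|~: (e |: H)|.+1.
    by rewrite setCU setIC -setDE (cardsD1 e (~: H)) inE eH.
  by rewrite !exprS; ring.
have cycles : x ^+ #|F| * (1 - x) ^+ #|~: F| / Zflow G q x *
      \sum_(t : 'Z_q | t != 0) \sum_(C in CC | (C \subset F) &&
          ((f', F') == ([ffun e => f e + t * chi q C (orient C) e], F)))
        p / (q%:R * #|CC|%:R) =
    x ^+ #|F'| * (1 - x) ^+ #|~: F'| / Zflow G q x *
      \sum_(t : 'Z_q | t != 0) \sum_(C in CC | (C \subset F') &&
          ((f, F) == ([ffun e => f' e + t * chi q C (orient C) e], F')))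
        p / (q%:R * #|CC|%:R).
  rewrite [in RHS](reindex_inj oppr_inj) /= !mulr_sumr.
  apply: eq_big => t; first by rewrite oppr_eq0.
  move=> _; rewrite !mulr_sumr; apply: eq_big => C.
    congr (_ && _); apply/andP/andP => -[CF /eqP[ff FF]].
      rewrite FF CF; split=> //; apply/eqP; congr pair.
      by apply/ffunP => e; rewrite ff !ffunE mulNr addrK.
    rewrite FF CF; split=> //; apply/eqP; congr pair.
    by apply/ffunP => e; rewrite ff !ffunE mulNr subrK.
  by case/and3P => _ _ /eqP[_ ->].
rewrite [LHS]mulrDr [RHS]mulrDr cycles; congr (_ + _).
rewrite [LHS]mulrDr [RHS]mulrDr (up_down f f' F F') //.
by rewrite -(up_down f' f F' F) // addrC.
Qed.

(** Expand a product over edges: an edge with nonzero flow contributes x, any other x + (1 - x) =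
    1. *)
Lemma sum_supersets (f : {ffun E -> 'Z_q}) :
  \sum_(F : {set E} | [forall e, (e \notin F) ==> (f e == 0)])
    x ^+ #|F| * (1 - x) ^+ #|~: F| = x ^+ #|[set e | f e != 0]|.
Proof.
transitivity (\prod_e (x + (if f e == 0 then 1 - x else 0))); last first.
  rewrite -prodr_const [RHS]big_mkcond /=; apply: eq_bigr => e _.
  by rewrite inE; case: eqP => _ /=; ring.
rewrite bigA_distr /= [LHS]big_mkcond /=; apply: eq_bigr => F _.
case: forallP => [sF|nsF].
  rewrite -!prodr_const big_mkcond [X in _ * X]big_mkcond -big_split /=.
  apply: eq_bigr => e _; rewrite inE; case: ifPn => eF /=; first by rewrite mulr1.
  by rewrite (implyP (sF e) eF) mul1r.
have /forallPn[e] : ~~ [forall e, (e \notin F) ==> (f e == 0)] by apply/forallP.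
rewrite negb_imply => /andP[eF fe].
by rewrite (bigD1 e) //= (negPf eF) (negPf fe) mul0r.
Qed.

Lemma Zflow_gt0 : 0 < Zflow G q x.
Proof.
rewrite /Zflow (bigD1 ([ffun=> 0] : {ffun E -> 'Z_q})) /=; last first.
  apply/andP; split; first by apply/forallP => e; rewrite inE.
  by apply/forallP => v; rewrite !big1 // => e _; rewrite ffunE.
apply: ltr_pwDl; first exact: exprn_gt0.
by apply: sumr_ge0 => f _; rewrite exprn_ge0 // ltW.
Qed.

Lemma mu_flowRC_ge0 (a : Omega) : 0 <= mu a.
Proof.
by rewrite divr_ge0 ?mulr_ge0 ?exprn_ge0 ?subr_ge0 //
  ltW // Zflow_gt0.
Qed.

Lemma mu_flowRC_sum1 : \sum_a mu a = 1.
Proof.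
rewrite /mu_flowRC -mulr_suml.
suff -> : \sum_(a : Omega) x ^+ #|(val a).2| * (1 - x) ^+ #|~: (val a).2| = Zflow G q x.
  by rewrite divff // gt_eqF // Zflow_gt0.
rewrite -(big_sub (fun w : config => flow_on G w.2 w.1)
  (fun w => x ^+ #|w.2| * (1 - x) ^+ #|~: w.2|)) /=.
transitivity (\sum_(f : {ffun E -> 'Z_q} | flow G f)
    \sum_(F : {set E} | [forall e, (e \notin F) ==> (f e == 0)])
    x ^+ #|F| * (1 - x) ^+ #|~: F|); last first.
  by apply: eq_bigr => f _; exact: sum_supersets.
rewrite pair_big_dep /=; apply: eq_bigl => -[f F] /=.
rewrite unfold_in /=; apply/flow_onP/andP => [[sF fl]|[fl /forallP sF]]; split=> //.
  by apply/forallP => e; apply/implyP => /sF ->.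
by move=> e eF; apply/eqP/(implyP (sF e)).
Qed.

Lemma flowRC_tv_oscillation (a : Omega) t (eps : R) :
  (forall h, (forall b, `|h b| <= 1) ->
     forall c, iter t (transition_op trans) h a - iter t (transition_op trans) h c
       <= 2 * eps) ->
  total_variation (chain_law trans a t) mu <= eps.
Proof.
apply: total_variation_oscillation.
- exact: mu_flowRC_ge0.
- exact: mu_flowRC_sum1.
- exact: mu_reversible.
- exact: trans_stochastic.
Qed.

Hypotheses (p_gt0 : 0 < p) (p_lt1 : p < 1).

Lemma flowRC_mixing (al : R) (s l t : nat) (a : Omega) :
  (max_load CC <= s)%N -> (max_length CC <= l)%N -> al <= 1 ->
  al <= (1 - p) / #|E|%:R - p / #|CC|%:R * ((q%:R - 1) / q%:R * s%:R) ->
  ((0 < #|CC|)%N -> al <= p / #|CC|%:R - (1 - p) / #|E|%:R * ((1 - x) * l%:R)) ->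
  total_variation (chain_law trans a t) mu <=
    (2 * #|E| + #|CC|)%:R * (1 - al) ^+ t.
Proof.
move=> hs hl al_le1 al1 al2; apply: flowRC_tv_oscillation => h h1 c.
set aa := p / _ in al1 al2; set bb := (1 - p) / _ in al1 al2.
(* [average_op] acts on all pairs, so [h] is extended by 0 to pairs that are not states. *)
pose g (w : config) : R := if insub w is Some b then h b else 0.
have g1 w : `|g w| <= 1 by rewrite /g; case: insubP => [b _ _|_]; rewrite ?normr0.
have iterE k b : iter k (transition_op trans) h b =
    iter k (average_op CC orient x aa bb) g (val b).
  elim: k b => [|k IH] b /=; first by rewrite /g valK.
  rewrite -transition_op_average; apply: eq_bigr => b' _; congr (_ * _).
  exact: IH.
have aa0 : 0 <= aa by rewrite divr_ge0 // ltW.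
have bb0 : 0 <= bb by rewrite divr_ge0 // subr_ge0 ltW.
have ab1 : bb * #|E|%:R + aa * #|CC|%:R <= 1.
  (* Only an inequality holds, since division by 0 gives 0 when m or r is 0. *)
  have le_div (y : R) n : 0 <= y -> y / n%:R * n%:R <= y.
    by case: n => [|n] y0; rewrite ?mulr0 // divfK // pnatr_eq0.
  have p1 : 0 <= 1 - p by rewrite subr_ge0 ltW.
  have := le_div (1 - p) #|E| p1; have := le_div p #|CC| (ltW p_gt0).
  by rewrite -/aa -/bb; lra.
(* The initial constant 2 is the largest oscillation of a function bounded by 1; it cancels the 2 in
   [2 * eps]. *)
have lip k : lipschitz G CC orient (iter k (average_op CC orient x aa bb) g)
    ((1 - al) ^+ k * 2).
  elim: k => [|k IH] /=.
    rewrite mul1r; split=> [f F e _|f F C u _ _ _];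
      by apply: le_trans (ler_normB _ _) _; rewrite (_ : 2 = 1 + 1) ?lerD.
  rewrite exprS -mulrA.
  apply: (average_op_contracts hCC q_gt1 x_gt0 x_lt1 aa0 bb0 ab1 hs hl
    al1 al2 al_le1 _ IH).
  by rewrite mulr_ge0 // exprn_ge0 // subr_ge0.
rewrite !iterE; apply: le_trans (ler_norm _) _.
have := lipschitz_diameter hCC (lip t) (valP a) (valP c).
rewrite -!surjective_pairing => /le_trans; apply.
by rewrite [leRHS]mulrC mulrA.
Qed.

End FlowRC.

(** * Choice of the parameter and the mixing time bound *)

(* [p] equalises the contraction rates of the two kinds of adjacent pairs. *)
Lemma balanced_parameter (R : realType) (m r K L : R) :
  1 <= m -> 1 <= r -> 1 <= K -> 0 < L -> K * L < 1 ->
  exists p al, [/\ 0 < p < 1, 0 < al <= 1,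
      al = (1 - p) / m - p / r * K, al = p / r - (1 - p) / m * L
    & al^-1 + 1 <= 2 * (m + r) * K / (1 - K * L)].
Proof.
move=> m1 r1 K1 L0 KL.
(* Equal rates mean (1-p)(1+L)/m = p(1+K)/r, which is solved for p; the common rate follows. *)
exists (r * (1 + L) / (r * (1 + L) + m * (1 + K))).
exists ((1 - K * L) / (r * (1 + L) + m * (1 + K))).
have A0 : 1 < r * (1 + L) by nra.
have B0 : 2 <= m * (1 + K) by nra.
set N := r * (1 + L) + m * (1 + K).
have N3 : 3 < N by rewrite /N; lra.
have N0 : N != 0 by rewrite gt_eqF //; lra.
have KL0 : 0 < K * L by rewrite mulr_gt0 //; lra.
split.
- by apply/andP; split; [apply: divr_gt0; lra | rewrite ltr_pdivrMr; rewrite /N; lra].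
- by apply/andP; split; [apply: divr_gt0; lra | rewrite ler_pdivrMr; lra].
- by rewrite /N in N0 *; field; rewrite N0 /=; apply/andP; split; rewrite gt_eqF //; lra.
- by rewrite /N in N0 *; field; rewrite N0 /=; apply/andP; split; rewrite gt_eqF //; lra.
have k0 : 0 < 1 - K * L by lra.
rewrite invf_div ler_pdivlMr // mulrDl divfK ?gt_eqF // mul1r /N.
(* The slack equals m(K-1) + (r-1)(1-KL) + r(K-1)L + 2r(K-1). *)
have h1 : 0 <= m * (K - 1) by rewrite mulr_ge0 //; lra.
have h2 : 0 <= (r - 1) * (1 - K * L) by rewrite mulr_ge0 //; lra.
have h3 : 0 <= (K - 1) * L by rewrite mulr_ge0 //; lra.
have h4 : 0 <= r * ((K - 1) * L) by rewrite mulr_ge0 //; lra.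
have h5 : 0 <= r * (K - 1) by rewrite mulr_ge0 //; lra.
lra.
Qed.

Theorem theorem4p2 (R : realType) (l q s : nat) (x xi delta : R)
    (hl : (3 <= l)%N) (hq : (2 <= q)%N) (hs : (2 <= s)%N)
    (hx : 1 - q%:R / ((q%:R - 1) * l%:R * s%:R) < x) (hx1 : x < 1)
    (hxi : xi = x - (1 - q%:R / ((q%:R - 1) * l%:R * s%:R)))
    (hdelta : 0 < delta)
    (V E : finType) (G : multigraph V E) (m r : nat) (hm : #|E| = m)
    (CC : {set {set E}}) (orient : {set E} -> {set E})
    (hCC : even_generating_set G q CC orient) (hr : #|CC| = r)
    (hlC : (max_length CC <= l)%N) (hsC : (max_load CC <= s)%N) :
  exists p : R, 0 < p < 1 /\
    close_within (flowRC_trans (G := G) (q := q) CC orient x p)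
      (mu_flowRC (G := G) (q := q) x) delta
      (2 * (m + r)%:R / l%:R * ln ((2 * m + r)%:R * delta^-1) * xi^-1).
Proof.
have hl' : 3 <= l%:R :> R by rewrite ler_nat.
have hq' : 2 <= q%:R :> R by rewrite ler_nat.
have hs' : 2 <= s%:R :> R by rewrite ler_nat.
set K : R := (q%:R - 1) / q%:R * s%:R.
have K1 : 1 <= K.
  by rewrite /K mulrAC ler_pdivlMr; nra.
have Kl : 3 <= l%:R * K by nra.
have eK : q%:R / ((q%:R - 1) * l%:R * s%:R) = (l%:R * K)^-1 :> R.
  by rewrite /K; field; rewrite !gt_eqF //=; lra.
rewrite eK in hx hxi.
(* The lower bound on x is thus at least 2/3, whence x > 0. *)
have Kl_inv : (l%:R * K)^-1 <= 3^-1 by rewrite lef_pV2 // posrE; lra.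
have x_gt0 : 0 < x by lra.
set L := (1 - x) * l%:R.
have L0 : 0 < L by apply: mulr_gt0; lra.
(* The hypothesis on x amounts to KL < 1, and [xi] measures the gap. *)
have KL : 1 - K * L = K * (l%:R * xi).
  by rewrite hxi /L; field; rewrite !gt_eqF //=; lra.
have y0 : 0 < l%:R * xi by apply: mulr_gt0; lra.
have y1 : l%:R * xi <= 1 by have := mulr_gt0 (lt_le_trans ltr01 K1) L0; nra.
pose be := l%:R * xi / (2 * (m + r)%:R).
have eB : 2 * (m + r)%:R / l%:R * ln ((2 * m + r)%:R * delta^-1) * xi^-1 =
    be^-1 * ln ((2 * m + r)%:R / delta).
  by rewrite /be invf_div invfM; ring.
rewrite eB.
have bound_ge t B : t <= B -> t <= Num.max 0 B :> R.
  by move=> tB; rewrite le_max tB orbT.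
have half : 0 < 2^-1 :> R by lra.
have half1 : 2^-1 < 1 :> R by lra.
(* For delta >= 1 zero steps suffice, even if the logarithm is negative. *)
have [d1|d1] := leP 1 delta.
  exists 2^-1; split; first by rewrite half half1.
  exists 0%N; split; first by rewrite le_max lexx.
  move=> a; apply: flowRC_tv_oscillation => // h h1 c /=.
  have := h1 a; have := h1 c; rewrite !ler_norml => /andP[? ?] /andP[? ?]; lra.
(* Without edges there is a single state. *)
have [m0|m_gt0] := posnP m.
  exists 2^-1; split; first by rewrite half half1.
  exists 0%N; split; first by rewrite le_max lexx.
  move=> a; apply: flowRC_tv_oscillation => // h h1 c /=.
  suff -> : c = a by rewrite subrr mulr_ge0 // ltW.
  have E0 (e : E) : False by have := card0_eq (etrans hm m0) e; rewrite inE.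
  apply/val_inj; rewrite [val c]surjective_pairing [val a]surjective_pairing.
  by congr pair; [apply/ffunP => e|apply/setP => e]; case: (E0 e).
have m1 : 1 <= m%:R :> R by rewrite ler1n.
have [r0|r_gt0] := posnP r; last first.
  have r1 : 1 <= r%:R :> R by rewrite ler1n.
  have KL1 : K * L < 1 by have := mulr_gt0 (lt_le_trans ltr01 K1) y0; lra.
  have [p [al [/andP[p0 p1] al01 al1 al2 gap]]] :=
    balanced_parameter m1 r1 K1 L0 KL1.
  exists p; split; first by rewrite p0 p1.
  have be0 : 0 < be.
    by rewrite /be natrD; apply: divr_gt0 => //; lra.
  (* The right side of [gap] is exactly [be^-1]: the factor K cancels. *)
  have gap' : al^-1 + 1 <= be^-1.
    apply: le_trans gap _; rewrite KL /be natrD invf_div le_eqVlt.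
    by apply/orP; left; apply/eqP; field; rewrite !gt_eqF //=; lra.
  have D3 : 3 <= (2 * m + r)%:R :> R by rewrite natrD natrM; lra.
  have d01 : 0 < delta < 1 by rewrite hdelta d1.
  have [t [tB Dt]] := geometric_time al01 be0 gap' D3 d01.
  exists t; split; first exact: bound_ge.
  move=> a; apply: le_trans Dt; rewrite -hm -hr.
  case/andP: al01 => _ al_le1.
  apply: (flowRC_mixing hCC hq x_gt0 hx1 _ _ _ _ hsC hlC) => //; rewrite hm hr.
    by rewrite al1.
  by rewrite al2.
have cycle_rate0 p (a : R) : p / #|CC|%:R * a = 0 by rewrite hr r0 invr0 mulr0 mul0r.
have no_cycle (P : Prop) : (0 < #|CC|)%N -> P by rewrite hr r0.
have [m2|m2] := leqP 2 m.
  have m2' : 2 <= m%:R :> R by rewrite ler_nat.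
  (* Only edge moves contract here. With p = 1/4 the gap requires 4m/3 + 1 <= 2m, which holds from m
     = 2 on. *)
  exists 4^-1; split; first by apply/andP; split; lra.
  pose al := (1 - 4^-1) / m%:R : R.
  have al01 : 0 < al <= 1.
    by apply/andP; split; [apply: divr_gt0; lra | rewrite ler_pdivrMr; lra].
  have be0 : 0 < be.
    by rewrite /be natrD; apply: divr_gt0 => //; rewrite r0; lra.
  have gap : al^-1 + 1 <= be^-1.
    rewrite /al /be r0 addn0 !invf_div ler_pdivlMr //.
    have -> : m%:R / (1 - 4^-1) = 4 / 3 * m%:R :> R by field.
    by nra.
  have D3 : 3 <= (2 * m + r)%:R :> R by rewrite r0 addn0 natrM; lra.
  have d01 : 0 < delta < 1 by rewrite hdelta d1.
  have [t [tB Dt]] := geometric_time al01 be0 gap D3 d01.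
  exists t; split; first exact: bound_ge.
  move=> a; apply: le_trans Dt; rewrite -hm -hr.
  case/andP: al01 => _ al_le1.
  apply: (flowRC_mixing hCC hq x_gt0 hx1 _ _ _ _ hsC hlC) => //; try lra.
    by rewrite cycle_rate0 subr0 hm.
  exact: no_cycle.
(* With a single edge the gap of [geometric_time] is missing: one step with small
   [p] suffices. *)
have {m2 m_gt0} em : m = 1%N by case: m m_gt0 m2 {hm m1 be eB} => [|[|]].
exists (delta / 4); split; first by apply/andP; split; lra.
exists 1%N; split.
  apply: bound_ge; rewrite /be em r0 !addn0 muln1 mulr1 invf_div mulrAC.
  rewrite ler_pdivlMr // mul1r.
  apply: le_trans y1 _.
  (* Since 2/delta need only exceed 2, the factor 2 of the time bound is used to square it before
     [ln_ge1] applies. *)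
  have z4 : 3 <= (2 / delta) ^+ 2.
    have z2 : 2 <= 2 / delta by rewrite ler_pdivlMr //; lra.
    by rewrite expr2; nra.
  by have := ln_ge1 z4; rewrite lnXn ?divr_gt0 // -[_ *+ 2]mulr_natl.
move=> a.
(* Here 2m + r = 2 and the rate is 1 - delta/4, so one step leaves at most delta/2. *)
apply: le_trans (_ : (2 * #|E| + #|CC|)%:R * (1 - (1 - delta / 4)) ^+ 1 <= _).
  apply: (flowRC_mixing hCC hq x_gt0 hx1 _ _ _ _ hsC hlC) => //; try lra.
    by rewrite cycle_rate0 subr0 hm em divr1.
  exact: no_cycle.
by rewrite hm hr em r0 expr1 /=; lra.
Qed.
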